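(* Let $0\le\alpha<\pi/2$ and let $A\in\mathbb{M}_m(\mathbb{M}_n)$ satisfy $W(A)\subseteq S_\alpha$. Then \[ (\mathrm{tr}|A|)^{mn}+|\det(\mathrm{tr}_1 A)|^m\ge (m\cos\alpha)^{mn}\big(\det|A|+|\det(\mathrm{tr}_2 A)|^n\big), \] and \[ (\mathrm{tr}|A|)^{mn}+|\det(\mathrm{tr}_2 A)|^n\ge (n\cos\alpha)^{mn}\big(\det|A|+|\det(\mathrm{tr}_1 A)|^m\big). \]
   Context: $\mathbb{M}_m(\mathbb{M}_n)$ denotes the set of $mn\times mn$ complex matrices partitioned as $A=[A_{i,j}]_{i,j=1}^m$ with each block $A_{i,j}$ an $n\times n$ complex matrix. The partial traces are $\mathrm{tr}_1 A=\sum_{i=1}^m A_{i,i}\in\mathbb{M}_n$ and $\mathrm{tr}_2 A=[\mathrm{tr}\,A_{i,j}]_{i,j=1}^m\in\mathbb{M}_m$. Here $|A|=(A^*A)^{1/2}$ is the matrix modulus. The numerical range of $A\in\mathbb{M}_p$ is $W(A)=\{x^*Ax: x\in\mathbb{C}^p, x^*x=1\}$, and for $\alpha\in[0,\pi/2)$, $S_\alpha=\{z\in\mathbb{C}: \Re z>0,\ |\Im z|\le (\Re z)\tan\alpha\}$. *)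

(* Defs.v *)
(* Complex numbers are modelled by an arbitrary
   numClosedFieldType C (e.g. algC; the complex field is such a structure). *)
From HB Require Import structures.
From mathcomp Require Import all_boot all_order all_algebra.
Set Implicit Arguments. Unset Strict Implicit. Unset Printing Implicit Defensive.
Import Order.TTheory GRing.Theory Num.Theory Num.Def.
Local Open Scope ring_scope.

Section Defs.
Variable C : numClosedFieldType.

Definition adjmx (p q : nat) (A : 'M[C]_(p, q)) : 'M[C]_(q, p) := (map_mx (@Num.conj C) A)^T.

(* matrix modulus |A| = (A^* A)^{1/2}: the positive semidefinite square root,
   built from the spectral (unitary) decomposition of the Hermitian A^* A:
   A^* A = U^* diag(d) U, |A| = U^* diag(sqrt d) U. *)
Definition mxabs (p : nat) (A : 'M[C]_p) : 'M[C]_p :=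
  let B := adjmx A *m A in
  adjmx (spectralmx B) *m diag_mx (map_mx sqrtC (spectral_diag B)) *m spectralmx B.

Definition in_numrange (p : nat) (A : 'M[C]_p) (z : C) : Prop :=
  exists x : 'cV[C]_p, (adjmx x *m x) 0 0 = 1 /\ z = (adjmx x *m A *m x) 0 0.

(* the sector S_alpha, where t = tan alpha *)
Definition in_sector (t z : C) : Prop :=
  0 < (Re z) /\ `|(Im z)| <= (Re z) * t.

(* block (i,j), entry (k,l) of A in M_m(M_n) is A (i*n+k) (j*n+l) *)
Definition blk (m n : nat) (A : 'M[C]_(m * n)) (i j : 'I_m) (k l : 'I_n) : C :=
  A (mxvec_index i k) (mxvec_index j l).

Definition ptr1 (m n : nat) (A : 'M[C]_(m * n)) : 'M[C]_n :=
  \matrix_(k, l) \sum_(i < m) blk A i i k l.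
Definition ptr2 (m n : nat) (A : 'M[C]_(m * n)) : 'M[C]_m :=
  \matrix_(i, j) \sum_(k < n) blk A i j k k.

End Defs.

(* Main.v *)
(** Write H for the Hermitian part of A, which is positive definite. The four
    terms compare in pairs.  A congruence diagonalises H and the skew part of A
    simultaneously, A = T^* diag(1 + i k_j) T with H = T^* T and |k_j| <= t,
    so that c^p |det A| <= det H <= |det A|; the same applies to the partial
    traces, which are again sectorial.
    - tr |A| >= |tr A| >= tr H = tr (tr_i H), and AM-GM for the eigenvalues of
      tr_i H bounds det (tr_i H).
    - det (tr_1 H)^m >= m^(mn) det H: after the congruence of H by I (x) S with
      S^* (tr_1 H) S = I, the trace of H becomes n, and AM-GM applies again. *)
Require Import Defs.
From HB Require Import structures.
From mathcomp Require Import all_boot all_order all_algebra.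
Import Order.TTheory GRing.Theory Num.Theory.
Local Open Scope ring_scope.

Set Implicit Arguments.
Unset Strict Implicit.
Unset Printing Implicit Defensive.

Local Notation "A ^!" := (adjmx A) : ring_scope.

(** * Adjoints, the spectral theorem and quadratic forms *)

Section Adjoint.
Variable C : numClosedFieldType.

Lemma adjmxE p q (A : 'M[C]_(p, q)) i j : A^! i j = (A j i)^*.
Proof. by rewrite !mxE. Qed.

Lemma adjmxK p q (A : 'M[C]_(p, q)) : A^!^! = A.
Proof. by apply/matrixP=> i j; rewrite !adjmxE conjCK. Qed.

Lemma adjmxM p q r (A : 'M[C]_(p, q)) (B : 'M[C]_(q, r)) :
  (A *m B)^! = B^! *m A^!.
Proof. by rewrite /adjmx map_mxM trmx_mul. Qed.

Lemma adjmxD p q (A B : 'M[C]_(p, q)) : (A + B)^! = A^! + B^!.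
Proof. by apply/matrixP=> i j; rewrite !(adjmxE, mxE) rmorphD. Qed.

Lemma adjmxN p q (A : 'M[C]_(p, q)) : (- A)^! = - A^!.
Proof. by apply/matrixP=> i j; rewrite !(adjmxE, mxE) rmorphN. Qed.

Lemma adjmxZ p q a (A : 'M[C]_(p, q)) : (a *: A)^! = a^* *: A^!.
Proof. by apply/matrixP=> i j; rewrite !(adjmxE, mxE) rmorphM. Qed.

Lemma adjmx1 p : (1%:M : 'M[C]_p)^! = 1%:M.
Proof. by rewrite /adjmx map_mx1 trmx1. Qed.

Lemma adjmx_sum (I : finType) p q (F : I -> 'M[C]_(p, q)) :
  (\sum_i F i)^! = \sum_i (F i)^!.
Proof. by rewrite /adjmx raddf_sum raddf_sum. Qed.

Lemma det_adjmx p (A : 'M[C]_p) : \det A^! = (\det A)^*.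
Proof. by rewrite /adjmx det_tr det_map_mx. Qed.

Lemma adjmx_trC p q (A : 'M[C]_(p, q)) : (A ^t* )%sesqui = A^!.
Proof. by rewrite /adjmx map_trmx. Qed.

Lemma spectral_unitary p (H : 'M[C]_p) :
  spectralmx H *m (spectralmx H)^! = 1%:M.
Proof. by rewrite -adjmx_trC; apply/unitarymxP/spectral_unitarymx. Qed.

Lemma spectral_decomposition p (H : 'M[C]_p) : H^! = H ->
  H = (spectralmx H)^! *m diag_mx (spectral_diag H) *m spectralmx H.
Proof.
move=> hH; have nH : H \is normalmx.
  by apply/normalmxP; rewrite adjmx_trC hH.
have := orthomx_spectralP nH => /=.
by rewrite invmx_unitary ?spectral_unitarymx // adjmx_trC.
Qed.

Definition qform p (A : 'M[C]_p) (x : 'cV[C]_p) : C := (x^! *m A *m x) 0 0.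

Lemma qformD p (A B : 'M[C]_p) x : qform (A + B) x = qform A x + qform B x.
Proof. by rewrite /qform mulmxDr mulmxDl mxE. Qed.

Lemma qformZ p a (A : 'M[C]_p) x : qform (a *: A) x = a * qform A x.
Proof. by rewrite /qform -scalemxAr -scalemxAl mxE. Qed.

Lemma qform_adj p (A : 'M[C]_p) x : qform A^! x = (qform A x)^*.
Proof. by rewrite /qform -adjmxE !adjmxM adjmxK mulmxA. Qed.

Lemma qform_congr p q (T : 'M[C]_(q, p)) (A : 'M[C]_q) x :
  qform (T^! *m A *m T) x = qform A (T *m x).
Proof. by rewrite /qform adjmxM !mulmxA. Qed.

Lemma qform_delta p (A : 'M[C]_p) j : qform A (delta_mx j 0) = A j j.
Proof.
rewrite /qform -mulmxA -colE mxE (bigD1 j) //= big1 ?addr0.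
  by rewrite adjmxE !mxE !eqxx rmorph1 mul1r.
by move=> k kj; rewrite adjmxE !mxE (negPf kj) rmorph0 mul0r.
Qed.

Lemma sqnorm_gt0 p (x : 'cV[C]_p) : x != 0 -> 0 < (x^! *m x) 0 0.
Proof.
move=> x0; have [j xj] : exists j, x j 0 != 0.
  apply/existsP; apply: contraNT x0; rewrite negb_exists => /forallP h.
  by apply/eqP/colP=> j; rewrite mxE; apply/eqP; move: (h j); rewrite negbK.
rewrite mxE (bigD1 j) //= ltr_wpDr //.
  by apply: sumr_ge0 => k _; rewrite adjmxE mulrC mul_conjC_ge0.
by rewrite adjmxE mulrC mul_conjC_gt0.
Qed.

Lemma unitmx_mul_neq0 p (T : 'M[C]_p) (x : 'cV[C]_p) :
  T \in unitmx -> x != 0 -> T *m x != 0.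
Proof.
by move=> uT; apply: contra_neq => h; rewrite -[x](mulKmx uT) h mulmx0.
Qed.

Lemma delta_col_neq0 p (j : 'I_p) : delta_mx j 0 != 0 :> 'cV[C]_p.
Proof.
by apply/eqP => /matrixP/(_ j 0); rewrite !mxE !eqxx => /eqP; rewrite oner_eq0.
Qed.

(** * Positive definite matrices *)

Definition posdefmx p (H : 'M[C]_p) :=
  H^! = H /\ forall x, x != 0 -> 0 < qform H x.

Lemma posdef_congr p (T H : 'M[C]_p) :
  T \in unitmx -> posdefmx H -> posdefmx (T^! *m H *m T).
Proof.
move=> uT [hH pH]; split; first by rewrite !adjmxM adjmxK hH mulmxA.
by move=> x x0; rewrite qform_congr pH ?unitmx_mul_neq0.
Qed.

Lemma spectral_diagE p (H : 'M[C]_p) j : H^! = H ->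
  spectral_diag H 0 j = (spectralmx H *m H *m (spectralmx H)^!) j j.
Proof.
move=> hH; have UU := spectral_unitary H.
rewrite {3}(spectral_decomposition hH) !mulmxA UU mul1mx.
by rewrite -mulmxA UU mulmx1 mxE eqxx.
Qed.

(** The vector is the [j]-th eigenvector, so sign information on the form passes to the
    eigenvalues. *)
Lemma spectral_diag_qform p (H : 'M[C]_p) j : H^! = H ->
  spectral_diag H 0 j = qform H ((spectralmx H)^! *m delta_mx j 0).
Proof.
by move=> hH; rewrite -qform_congr adjmxK qform_delta spectral_diagE.
Qed.

Lemma posdef_spectral_gt0 p (H : 'M[C]_p) : posdefmx H ->
  forall j, 0 < spectral_diag H 0 j.
Proof.
move=> [hH pH] j; rewrite spectral_diag_qform //.
apply/pH/unitmx_mul_neq0; last exact: delta_col_neq0.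
by have [] := mulmx1_unit (spectral_unitary H).
Qed.

Lemma det_spectral p (H : 'M[C]_p) : H^! = H ->
  \det H = \prod_j spectral_diag H 0 j.
Proof.
move=> /spectral_decomposition {1}->; rewrite !det_mulmx mulrAC -det_mulmx.
by rewrite (mulmx1C (spectral_unitary H)) det1 mul1r det_diag.
Qed.

Lemma tr_spectral p (H : 'M[C]_p) : H^! = H ->
  \tr H = \sum_j spectral_diag H 0 j.
Proof.
move=> /spectral_decomposition {1}->; rewrite mxtrace_mulC mulmxA.
by rewrite spectral_unitary mul1mx mxtrace_diag.
Qed.

Lemma posdef_det_gt0 p (H : 'M[C]_p) : posdefmx H -> 0 < \det H.
Proof.
move=> pH; rewrite det_spectral; last by case: pH.
by apply: prodr_gt0 => j _; apply: posdef_spectral_gt0.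
Qed.

Lemma posdef_AGM p (H : 'M[C]_p) : posdefmx H ->
  p%:R ^+ p * \det H <= (\tr H) ^+ p.
Proof.
move=> pH; have hH : H^! = H by case: pH.
rewrite (det_spectral hH) (tr_spectral hH).
(* The scaled form of AM-GM multiplies each eigenvalue by [p], which avoids division and roots. *)
have := @leif_AGM_scaled C 'I_p predT (fun j => spectral_diag H 0 j).
rewrite card_ord => /(_ _)[|+ _].
  by move=> j _; rewrite mulrn_wge0 ?ltW ?posdef_spectral_gt0.
by rewrite prodrMn_const card_ord mulrC -natrX mulr_natr.
Qed.

(** With [H = U^* diag(d) U], take [T = diag(sqrt d) U]; it is invertible because every [d_j] is
    positive. *)
Lemma posdef_factor p (H : 'M[C]_p) : posdefmx H ->
  exists2 T : 'M[C]_p, T \in unitmx & H = T^! *m T.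
Proof.
move=> pH; have hH : H^! = H by case: pH.
set d := spectral_diag H; pose D : 'M[C]_p := diag_mx (map_mx sqrtC d).
have sd j : 0 < sqrtC (d 0 j) by rewrite sqrtC_gt0 posdef_spectral_gt0.
exists (D *m spectralmx H).
  rewrite unitmx_mul spectral_unit andbT unitmxE unitfE det_diag.
  by apply/prodf_neq0 => j _; rewrite mxE gt_eqF.
have DD : D^! *m D = diag_mx d.
  have -> : D^! = D.
    apply/matrixP=> i j; rewrite adjmxE !mxE eq_sym.
    case: eqP => [->|_]; last by rewrite !mulr0n rmorph0.
    by rewrite !mulr1n; apply/CrealP; rewrite gtr0_real.
  rewrite mulmx_diag; congr diag_mx; apply/rowP=> j; rewrite !mxE.
  by rewrite -expr2 sqrtCK.
rewrite adjmxM mulmxA -[_ *m D^! *m D]mulmxA DD.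
exact: spectral_decomposition.
Qed.

(** * Determinant and trace of the modulus *)

Lemma mxabsE p (A : 'M[C]_p) (B := A^! *m A) :
  [/\ forall j, 0 <= spectral_diag B 0 j,
      \tr (mxabs A) = \sum_j sqrtC (spectral_diag B 0 j) &
      \det (mxabs A) = \prod_j sqrtC (spectral_diag B 0 j)].
Proof.
have hB : B^! = B by rewrite /B adjmxM adjmxK.
set U := spectralmx B; have UU : U *m U^! = 1%:M by apply: spectral_unitary.
split.
- move=> j; rewrite spectral_diag_qform //; set x := _ *m delta_mx j 0.
  (* The form of [A^* A] at [x] is the squared norm of [A x]. *)
  rewrite /B -[A^!]mulmx1 qform_congr /qform mulmx1.
  have [->|/sqnorm_gt0/ltW//] := eqVneq (A *m x) 0.
  by rewrite mulmx0 mxE.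
- rewrite /mxabs -/B -/U mxtrace_mulC mulmxA UU mul1mx mxtrace_diag.
  by apply: eq_bigr => j _; rewrite mxE.
- rewrite /mxabs -/B -/U !det_mulmx mulrAC -det_mulmx (mulmx1C UU) det1 mul1r.
  by rewrite det_diag; apply: eq_bigr => j _; rewrite mxE.
Qed.

(** Both sides are nonnegative and their squares are the determinant of [A^* A]. *)
Lemma det_mxabs p (A : 'M[C]_p) : \det (mxabs A) = `|\det A|.
Proof.
have [d0 _ ->] := mxabsE A.
apply/eqP; rewrite -(eqrXn2 (n := 2)) ?prodr_ge0 //; last first.
  by move=> j _; rewrite sqrtC_ge0.
rewrite -prodrXl (eq_bigr _ (fun j _ => sqrtCK _)) -det_spectral.
  by rewrite det_mulmx det_adjmx normCK mulrC.
by rewrite adjmxM adjmxK.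
Qed.

(** In an eigenbasis of [A^* A], the trace of [A] is a sum of inner products of the rows of [U] and
    [U A^*]. Cauchy-Schwarz bounds each by a singular value, since the rows of [U] are unit
    vectors. *)
Lemma norm_tr_le_tr_mxabs p (A : 'M[C]_p) : `|\tr A| <= \tr (mxabs A).
Proof.
have [d0 -> _] := mxabsE A; set B := A^! *m A; set U := spectralmx B.
have UU : U *m U^! = 1%:M by apply: spectral_unitary.
have -> : \tr A = \tr (U *m (U *m A^!)^!).
  by rewrite adjmxM adjmxK mxtrace_mulC -mulmxA (mulmx1C UU) mulmx1.
apply: le_trans (ler_norm_sum _ _ _) _; apply: ler_sum => j _.
have dotE (X Y : 'M[C]_p) : dotmx (row j X) (row j Y) = (X *m Y^!) j j.
  by rewrite dotmxE adjmx_trC !mxE; apply: eq_bigr => k _; rewrite !mxE.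
have := (CauchySchwarz_sqrt (@dotmx C p) (row j U) (row j (U *m A^!))).1.
rewrite /= !dotE UU [1%:M j j]mxE eqxx sqrtC1 mul1r.
suff -> : (U *m A^! *m (U *m A^!)^!) j j = spectral_diag B 0 j by [].
have hB : B^! = B by rewrite /B adjmxM adjmxK.
by rewrite spectral_diagE // -/U adjmxM adjmxK /B !mulmxA.
Qed.

End Adjoint.

(** * Sectorial matrices and their Hermitian parts *)

Section Sectorial.
Variable C : numClosedFieldType.

Definition Remx p (A : 'M[C]_p) : 'M[C]_p := 2^-1 *: (A + A^!).
Definition Immx p (A : 'M[C]_p) : 'M[C]_p := ('i / 2) *: (A^! - A).

Lemma mxRect p (A : 'M[C]_p) : A = Remx A + 'i *: Immx A.
Proof.
rewrite /Remx /Immx scalerA mulrA -expr2 sqrCi mulN1r scaleNr -scalerN opprB.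
by rewrite -scalerDr addrACA subrr addr0 -mulr2n -scaler_nat scalerA mulVf
  ?scale1r ?pnatr_eq0.
Qed.

Lemma conjC_inv2 : (2^-1 : C)^* = 2^-1.
Proof. by apply/CrealP; rewrite rpredV realn. Qed.

Lemma Remx_herm p (A : 'M[C]_p) : (Remx A)^! = Remx A.
Proof. by rewrite /Remx adjmxZ adjmxD adjmxK addrC conjC_inv2. Qed.

Lemma Immx_herm p (A : 'M[C]_p) : (Immx A)^! = Immx A.
Proof.
rewrite /Immx adjmxZ adjmxD adjmxN adjmxK rmorphM /= conjCi conjC_inv2.
by rewrite mulNr scaleNr -scalerN opprB.
Qed.

Lemma qform_Remx p (A : 'M[C]_p) x : qform (Remx A) x = 'Re (qform A x).
Proof. by rewrite qformZ qformD qform_adj ReE mulrC. Qed.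

Lemma qform_Immx p (A : 'M[C]_p) x : qform (Immx A) x = 'Im (qform A x).
Proof.
by rewrite qformZ qformD -scaleN1r qformZ mulN1r qform_adj ImE mulrAC.
Qed.

Lemma tr_Remx p (A : 'M[C]_p) : \tr (Remx A) = 'Re (\tr A).
Proof.
rewrite mxtraceZ raddfD /= ReE mulrC; congr ((_ + _) / _).
by rewrite /adjmx mxtrace_tr trace_map_mx.
Qed.

(** The sector is a cone, so the numerical range condition can be stated without normalising [x];
    this form survives congruences and sums. *)
Definition sectorial (t : C) p (A : 'M[C]_p) :=
  forall x, x != 0 -> in_sector t (qform A x).

Lemma in_sectorM (t a z : C) : 0 < a -> in_sector t z -> in_sector t (a * z).
Proof.
move=> a0 [re im]; have aR : a \is Num.real by rewrite gtr0_real.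
have h : 'Re (a * z) = a * 'Re z.
  by rewrite ReM (Creal_ReP _ aR) (Creal_ImP _ aR) mul0r subr0.
have h' : 'Im (a * z) = a * 'Im z.
  by rewrite ImM (Creal_ReP _ aR) (Creal_ImP _ aR) mulr0 addr0.
split; first by rewrite h mulr_gt0.
by rewrite h h' normrM (gtr0_norm a0) -mulrA ler_pM2l.
Qed.

Lemma in_sectorD (t z w : C) :
  in_sector t z -> in_sector t w -> in_sector t (z + w).
Proof.
move=> [z1 z2] [w1 w2]; split; first by rewrite raddfD addr_gt0.
by rewrite !raddfD mulrDl (le_trans (ler_normD _ _)) ?lerD.
Qed.

Lemma sectorial_numrange t p (A : 'M[C]_p) :
  (forall z, in_numrange A z -> in_sector t z) -> sectorial t A.
Proof.
move=> hW x x0; have n0 := sqnorm_gt0 x0.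
set s := (x^! *m x) 0 0 in n0; set r := sqrtC s.
have r0 : 0 < r by rewrite sqrtC_gt0.
have rR : (r^-1)^* = r^-1 by apply/CrealP; rewrite rpredV gtr0_real.
have E (B : 'M[C]_p) : qform B (r^-1 *: x) = s^-1 * qform B x.
  rewrite /qform adjmxZ rR -scalemxAr -!scalemxAl !mxE mulrA.
  by rewrite -invfM -expr2 sqrtCK.
have s0 : s != 0 by rewrite gt_eqF.
rewrite -[qform A x](mulVKf s0) -E; apply: in_sectorM => //.
apply: hW; exists (r^-1 *: x); split=> //.
by have := E 1%:M; rewrite /qform !mulmx1 => ->; rewrite -/s mulVf.
Qed.

Lemma sectorial_posdef t p (A : 'M[C]_p) : sectorial t A -> posdefmx (Remx A).
Proof.
move=> sA; split; first exact: Remx_herm.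
by move=> x /sA [re _]; rewrite qform_Remx.
Qed.

Lemma sectorial_decomposition t p (A : 'M[C]_p) : sectorial t A ->
  exists (T : 'M[C]_p) (k : 'rV[C]_p),
  [/\ Remx A = T^! *m T, A = T^! *m diag_mx (\row_j (1 + 'i * k 0 j)) *m T,
      forall j, k 0 j \is Num.real & forall j, `|k 0 j| <= t].
Proof.
move=> sA; have [T0 uT0 HE] := posdef_factor (sectorial_posdef sA).
(* [K] is the skew part in coordinates where the Hermitian part is the identity; diagonalising [K]
   by a unitary [V] keeps that identity. *)
pose S := invmx T0; pose K := S^! *m Immx A *m S.
have hK : K^! = K by rewrite /K !adjmxM adjmxK Immx_herm mulmxA.
set V := spectralmx K; set k := spectral_diag K.
have VV : V *m V^! = 1%:M by apply: spectral_unitary.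
have VV' : V^! *m V = 1%:M by apply: mulmx1C.
have ST : S *m T0 = 1%:M by apply: mulVmx.
have TS : T0 *m S = 1%:M by apply: mulmxV.
have TS' : T0^! *m S^! = 1%:M by rewrite -adjmxM ST adjmx1.
have KE : Immx A = (V *m T0)^! *m diag_mx k *m (V *m T0).
  have -> : (V *m T0)^! *m diag_mx k *m (V *m T0) =
            T0^! *m (V^! *m diag_mx k *m V) *m T0 by rewrite adjmxM !mulmxA.
  rewrite -(spectral_decomposition hK) /K !mulmxA TS' mul1mx -mulmxA ST.
  by rewrite mulmx1.
have RE : Remx A = (V *m T0)^! *m (V *m T0).
  by rewrite adjmxM mulmxA -[_ *m _ *m V]mulmxA VV' mulmx1.
(* [y j] is the preimage of the [j]-th basis vector under [V T0]. The form of [A] there is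
   [1 + i k_j], so the sector condition bounds [k_j]. *)
pose y j := S *m (V^! *m delta_mx j 0) : 'cV[C]_p.
have y0 j : y j != 0.
  apply: unitmx_mul_neq0; first by rewrite unitmx_inv.
  apply: unitmx_mul_neq0 (delta_col_neq0 C j).
  by case/mulmx1_unit: VV.
have Ty j : (V *m T0) *m y j = delta_mx j 0.
  by rewrite /y !mulmxA -[V *m T0 *m _]mulmxA TS mulmx1 VV mul1mx.
have ky j : 'Im (qform A (y j)) = k 0 j.
  by rewrite -qform_Immx KE qform_congr Ty qform_delta mxE eqxx.
have ry j : 'Re (qform A (y j)) = 1.
  rewrite -qform_Remx RE -[(V *m T0)^!]mulmx1 qform_congr Ty qform_delta.
  by rewrite mxE eqxx.
exists (V *m T0), k; split=> //.
- rewrite {1}[A]mxRect RE KE scalemxAl scalemxAr -{1}[(V *m T0)^!]mulmx1.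
  rewrite -mulmxDl -mulmxDr; congr (_ *m _ *m _).
  apply/matrixP=> i j; rewrite !mxE.
  by case: eqP; rewrite ?(mulr1n, mulr0n, mulr0, addr0).
- by move=> j; rewrite -ky Creal_Im.
- by move=> j; have [_] := sA _ (y0 j); rewrite ky ry mul1r.
Qed.

(** The two determinants differ by the product of the [|1 + i k_j|], each at least 1. *)
Lemma det_Remx_le t p (A : 'M[C]_p) : sectorial t A ->
  \det (Remx A) <= `|\det A|.
Proof.
move=> /sectorial_decomposition [T [k [-> -> kR _]]].
rewrite !det_mulmx det_adjmx mulrAC normrM -normCKC.
rewrite [`|_ ^+ 2|]ger0_norm ?exprn_ge0 // ler_peMr ?exprn_ge0 //.
rewrite det_diag normr_prod.
apply: (@le_trans _ _ (\prod_(j < p) 1)); first by rewrite big1_eq.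
apply: ler_prod => j _; rewrite ler01 mxE /=.
rewrite -(@ler_pXn2r _ 2) ?nnegrE // normC2_rect ?rpred1 // expr1n lerDl.
by rewrite real_exprn_even_ge0.
Qed.

Lemma det_le_Remx c t p (A : 'M[C]_p) : 0 < c -> 0 <= t ->
  c ^+ 2 * (1 + t ^+ 2) = 1 -> sectorial t A ->
  c ^+ p * `|\det A| <= \det (Remx A).
Proof.
move=> c0 t0 ct /sectorial_decomposition [T [k [-> -> kR kt]]].
rewrite !det_mulmx det_adjmx [X in `|X|]mulrAC normrM -normCKC.
rewrite [`|_ ^+ 2|]ger0_norm ?exprn_ge0 // mulrCA ler_piMr ?exprn_ge0 //.
(* Each of the [p] diagonal factors receives one [c]; then
   [c^2 (1 + k_j^2) <= c^2 (1 + t^2) = 1]. *)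
rewrite det_diag normr_prod -{1}(card_ord p) -prodr_const -big_split /=.
have c_ge0 := ltW c0.
apply: prodr_ile1 => j _; rewrite mxE mulr_ge0 //=.
rewrite -(@expr_le1 _ 2) ?mulr_ge0 // exprMn normC2_rect ?rpred1 //.
rewrite expr1n -[X in _ <= X]ct ler_pM2l ?exprn_gt0 // lerD2l -real_normK //.
by rewrite lerXn2r ?nnegrE.
Qed.

End Sectorial.

(** * Partial traces and block-diagonal congruences *)

(* Both partial traces are instances of [ptr] for an indexing [e] of the pairs
   (i, k): [tr_1] uses [mxvec_index], [tr_2] its transpose. *)
Section PartialTrace.
Variables (C : numClosedFieldType) (m n p : nat) (e : 'I_m -> 'I_n -> 'I_p).
Hypothesis e_bij : bijective (fun x : 'I_m * 'I_n => e x.1 x.2).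

Definition ptr (A : 'M[C]_p) : 'M[C]_n :=
  \matrix_(k, l) \sum_(i < m) A (e i k) (e i l).

(** The selector of the [i]-th block of a vector; its adjoint embeds a vector as the [i]-th
    block. *)
Definition sel i : 'M[C]_(n, p) := \matrix_(k, x) (e i k == x)%:R.

(* The matrix of [I_m] tensored with [T]. *)
Definition tens (T : 'M[C]_n) : 'M[C]_p := \sum_i (sel i)^! *m T *m sel i.

Lemma index_card : p = (m * n)%N.
Proof. by rewrite -[p]card_ord -(bij_eq_card e_bij) card_prod !card_ord. Qed.

Lemma index_eq i j k l : (e i k == e j l) = (i == j) && (k == l).
Proof.
by rewrite (inj_eq (bij_inj e_bij) (i, k) (j, l)) xpair_eqE.
Qed.

Lemma mul_sel i q (A : 'M[C]_(p, q)) k x : (sel i *m A) k x = A (e i k) x.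
Proof.
rewrite mxE (bigD1 (e i k)) //= mxE eqxx mul1r big1 ?addr0 // => y yk.
by rewrite mxE eq_sym (negPf yk) mul0r.
Qed.

Lemma mul_adj_sel i q (A : 'M[C]_(q, p)) x k :
  (A *m (sel i)^!) x k = A x (e i k).
Proof.
by rewrite -[A in LHS]adjmxK -adjmxM [LHS]adjmxE mul_sel adjmxE conjCK.
Qed.

Lemma ptrE A : ptr A = \sum_i sel i *m A *m (sel i)^!.
Proof.
apply/matrixP=> k l; rewrite summxE mxE.
by apply: eq_bigr => i _; rewrite mul_adj_sel mul_sel.
Qed.

Lemma sel_adj i j : sel i *m (sel j)^! = if i == j then 1%:M else 0.
Proof.
apply/matrixP=> k l; rewrite mul_adj_sel mxE index_eq.
by case: (i == j); rewrite mxE.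
Qed.

Lemma sel_resolution : \sum_i (sel i)^! *m sel i = 1%:M.
Proof.
apply/matrixP=> x y; rewrite summxE.
have -> : \sum_i ((sel i)^! *m sel i) x y =
          \sum_i \sum_k (e i k == x)%:R * (e i k == y)%:R.
  apply: eq_bigr => i _; rewrite mxE; apply: eq_bigr => k _.
  by rewrite adjmxE !mxE rmorph_nat.
rewrite pair_bigA /=.
(* By bijectivity of [e], the sum over pairs runs once over all indices [z]. *)
transitivity (\sum_z (z == x)%:R * (z == y)%:R : C).
  by rewrite [RHS](reindex _ (onW_bij _ e_bij)).
rewrite (bigD1 x) //= eqxx mul1r big1 ?addr0 ?mxE // => z /negPf ->.
by rewrite mul0r.
Qed.

Lemma sel_tens i T : sel i *m tens T = T *m sel i.
Proof.
rewrite /tens mulmx_sumr (bigD1 i) //= !mulmxA sel_adj eqxx mul1mx.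
rewrite big1 ?addr0 //.
by move=> j ji; rewrite !mulmxA sel_adj eq_sym (negPf ji) !mul0mx.
Qed.

Lemma tens_adj T : (tens T)^! = tens T^!.
Proof.
by rewrite adjmx_sum; apply: eq_bigr => i _; rewrite !adjmxM adjmxK mulmxA.
Qed.

Lemma tensM S T : tens (S *m T) = tens S *m tens T.
Proof.
rewrite {2}/tens mulmx_suml; apply: eq_bigr => i _.
by rewrite -[_ *m sel i *m _]mulmxA sel_tens !mulmxA.
Qed.

Lemma tens1 : tens 1%:M = 1%:M.
Proof.
by rewrite -sel_resolution; apply: eq_bigr => i _; rewrite mulmx1.
Qed.

(** The matrix stays diagonal, and each [d_k] occurs once per block. *)
Lemma det_tens_diag d : \det (tens (diag_mx d)) = (\prod_k d 0 k) ^+ m.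
Proof.
(* [f x] is the [d_k] with [e i k = x]; the sum has one surviving term and avoids naming the inverse
   of [e]. *)
pose f x := \sum_i \sum_k (e i k == x)%:R * d 0 k.
have fE i k : f (e i k) = d 0 k.
  rewrite /f (bigD1 i) //= (bigD1 k) //= eqxx mul1r !big1 ?addr0 //.
    move=> j ji; apply: big1 => l _.
    by rewrite index_eq (negPf ji) mul0r.
  by move=> l lk; rewrite index_eq (negPf lk) andbF mul0r.
have -> : tens (diag_mx d) = diag_mx (\row_x f x).
  have h i : (diag_mx d) *m sel i = sel i *m diag_mx (\row_x f x).
    apply/matrixP=> k x; rewrite mul_sel mul_diag_mx !mxE fE.
    by rewrite mulr_natr.
  rewrite /tens (eq_bigr (fun i => (sel i)^! *m sel i *m diag_mx (\row_x f x))).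
    by rewrite -mulmx_suml sel_resolution mul1mx.
  by move=> i _; rewrite -mulmxA h mulmxA.
rewrite det_diag (reindex _ (onW_bij _ e_bij)) /=.
rewrite -(pair_bigA _ (fun i k => (\row_x f x) 0 (e i k))) /=.
rewrite (eq_bigr (fun=> \prod_k d 0 k)) ?prodr_const ?card_ord // => i _.
by apply: eq_bigr => k _; rewrite mxE fE.
Qed.

(** Multiplicativity of [tens] carries the spectral decomposition over, reducing to the diagonal
    case. *)
Lemma det_tens P : P^! = P -> \det (tens P) = \det P ^+ m.
Proof.
move=> hP; rewrite (det_spectral hP) -det_tens_diag {1}(spectral_decomposition hP).
rewrite !tensM !det_mulmx mulrAC -det_mulmx -tensM.
by rewrite (mulmx1C (spectral_unitary P)) tens1 det1 mul1r.
Qed.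

(** [tens S] acts by the same [S] on every block, so [S] factors out of the sum over blocks. *)
Lemma ptr_congr S A : ptr ((tens S)^! *m A *m tens S) = S^! *m ptr A *m S.
Proof.
rewrite !ptrE mulmx_sumr mulmx_suml; apply: eq_bigr => i _.
rewrite tens_adj !mulmxA sel_tens -!mulmxA; do 3 congr (_ *m _).
by rewrite -[tens S]adjmxK tens_adj -adjmxM sel_tens adjmxM adjmxK.
Qed.

Lemma tr_ptr A : \tr (ptr A) = \tr A.
Proof.
rewrite ptrE raddf_sum /= -[A in RHS]mulmx1 -sel_resolution mulmx_sumr.
by rewrite raddf_sum; apply: eq_bigr => i _; rewrite /= -mulmxA mxtrace_mulC mulmxA.
Qed.

Lemma ptr_Remx A : ptr (Remx A) = Remx (ptr A).
Proof.
apply/matrixP=> k l; rewrite !mxE !rmorph_sum /= -big_split mulr_sumr.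
by apply: eq_bigr => i _; rewrite !mxE.
Qed.

Lemma qform_ptr A x : qform (ptr A) x = \sum_i qform A ((sel i)^! *m x).
Proof.
rewrite ptrE /qform mulmx_sumr mulmx_suml summxE.
by apply: eq_bigr => i _; rewrite adjmxM adjmxK !mulmxA.
Qed.

Lemma adj_sel_neq0 i (x : 'cV[C]_n) : x != 0 -> (sel i)^! *m x != 0.
Proof.
apply: contra_neq => h.
have <- : sel i *m ((sel i)^! *m x) = x by rewrite mulmxA sel_adj eqxx mul1mx.
by rewrite h mulmx0.
Qed.

(** * Determinant inequalities for partial traces *)

Hypothesis m_gt0 : (0 < m)%N.

Lemma sectorial_ptr t A : sectorial t A -> sectorial t (ptr A).
Proof.
move=> sA x x0; rewrite qform_ptr.
(* The empty sum 0 lies outside the sector, so the induction starts from one summand. *)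
rewrite (bigD1 (Ordinal m_gt0)) //=.
have h i : in_sector t (qform A ((sel i)^! *m x)) by apply/sA/adj_sel_neq0.
elim/big_rec: _ => [|i y _ IH]; first by rewrite addr0.
by rewrite addrCA; apply: in_sectorD.
Qed.

Lemma posdef_ptr H : posdefmx H -> posdefmx (ptr H).
Proof.
move=> [hH pH]; split.
  rewrite ptrE adjmx_sum; apply: eq_bigr => i _.
  by rewrite !adjmxM adjmxK hH mulmxA.
move=> x x0; rewrite qform_ptr (bigD1 (Ordinal m_gt0)) //=.
have h i : 0 < qform H ((sel i)^! *m x) by apply/pH/adj_sel_neq0.
by rewrite ltr_wpDr ?h ?sumr_ge0 // => i _; rewrite ltW.
Qed.

Hypothesis n_gt0 : (0 < n)%N.

Lemma det_le_det_ptr H : posdefmx H -> m%:R ^+ p * \det H <= \det (ptr H) ^+ m.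
Proof.
move=> pH; have pP := posdef_ptr pH.
have [T uT PE] := posdef_factor pP; pose S := invmx T.
have TS : T *m S = 1%:M by apply: mulmxV.
have SPS : S^! *m ptr H *m S = 1%:M.
  by rewrite PE !mulmxA -adjmxM TS adjmx1 mul1mx TS.
have utS : tens S \in unitmx.
  have /mulmx1_unit [_] // : tens T *m tens S = 1%:M by rewrite -tensM TS tens1.
pose H' := (tens S)^! *m H *m tens S.
have pH' : posdefmx H' by apply: posdef_congr.
(* The determinant of the congruence is read off from [S^* (ptr H) S = I] tensored with the
   identity. *)
have detH : \det H = \det H' * \det (ptr H) ^+ m.
  have : \det ((tens S)^! *m tens (ptr H) *m tens S) = 1.
    by rewrite tens_adj -!tensM SPS tens1 det1.
  rewrite -det_tens; last by case: pP.
  rewrite /H' !det_mulmx => h; rewrite -[LHS]mulr1 -h.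
  rewrite [_ * \det H in RHS]mulrC -!mulrA; congr (_ * (_ * _)).
  exact: mulrC.
have := posdef_AGM pH'.
(* As [H'] has trace [n], AM-GM reads [(m n)^p det H' <= n^p], and [n^p] cancels. *)
rewrite -tr_ptr /H' ptr_congr SPS mxtrace1 -/H' {1}index_card natrM exprMn.
rewrite mulrAC -[X in _ <= X]mul1r ler_pM2r ?exprn_gt0 ?ltr0n // => h.
rewrite detH mulrA -[X in _ <= X]mul1r ler_pM2r //.
by rewrite exprn_gt0 // posdef_det_gt0.
Qed.

Variables (c t : C) (A : 'M[C]_p).
Hypotheses (c_gt0 : 0 < c) (t_ge0 : 0 <= t) (ct : c ^+ 2 * (1 + t ^+ 2) = 1).
Hypothesis sA : sectorial t A.

(** The Hermitian part is the intermediary: the factor [c^p] pays for passing to it, [m^p] for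
    taking its partial trace, and returning from it to [ptr A] costs nothing. *)
Lemma det_mxabs_le_det_ptr :
  (m%:R * c) ^+ p * \det (mxabs A) <= `|\det (ptr A)| ^+ m.
Proof.
rewrite det_mxabs exprMn -mulrA.
apply: (@le_trans _ _ (m%:R ^+ p * \det (Remx A))).
  by rewrite ler_wpM2l ?exprn_ge0 ?ler0n //; apply: det_le_Remx sA.
apply: le_trans (det_le_det_ptr (sectorial_posdef sA)) _.
have sP := sectorial_ptr sA.
rewrite ptr_Remx lerXn2r ?nnegrE ?normr_ge0 ?(det_Remx_le sP) //.
by rewrite ltW // posdef_det_gt0 //; apply: sectorial_posdef sP.
Qed.

Lemma det_ptr_le_tr_mxabs :
  (n%:R * c) ^+ p * `|\det (ptr A)| ^+ m <= (\tr (mxabs A)) ^+ p.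
Proof.
have sP := sectorial_ptr sA; have pP := sectorial_posdef sP.
have p_nm : p = (n * m)%N by rewrite mulnC index_card.
have trR : 0 <= \tr (Remx (ptr A)).
  rewrite tr_spectral ?sumr_ge0 ?Remx_herm // => j _.
  by rewrite ltW // posdef_spectral_gt0.
apply: (@le_trans _ _ (\tr (Remx (ptr A)) ^+ p)).
  (* Since [p = n m], this is the [m]-th power of an inequality of degree [n], namely AM-GM for the
     Hermitian part of [ptr A]. *)
  rewrite {1}p_nm exprM -exprMn [X in _ <= _ ^+ X]p_nm exprM lerXn2r ?nnegrE //.
  - by rewrite mulr_ge0 // exprn_ge0 // mulr_ge0 ?ler0n // ltW.
  - by rewrite exprn_ge0.
  apply: le_trans (posdef_AGM pP); rewrite exprMn -mulrA.
  by rewrite ler_wpM2l ?exprn_ge0 ?ler0n //; apply: det_le_Remx sP.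
have tr_le : \tr (Remx (ptr A)) <= \tr (mxabs A).
  rewrite tr_Remx tr_ptr; apply: le_trans (norm_tr_le_tr_mxabs A).
  exact: (leif_Re_Creal (\tr A)).1.
by rewrite lerXn2r ?nnegrE ?(le_trans trR).
Qed.

End PartialTrace.

(* c = cos alpha, t = tan alpha, 0 <= alpha < pi/2 *)
Theorem theorem4p8 (C : numClosedFieldType) (m n : nat) (c t : C)
  (hm : (0 < m)%N) (hn : (0 < n)%N)
  (hc : 0 < c) (ht : 0 <= t) (hct : c ^+ 2 * (1 + t ^+ 2) = 1)
  (A : 'M[C]_(m * n))
  (hW : forall z, in_numrange A z -> in_sector t z) :
  ((m%:R * c) ^+ (m * n) * (\det (mxabs A) + `|\det (ptr2 A)| ^+ n)
     <= (\tr (mxabs A)) ^+ (m * n) + `|\det (ptr1 A)| ^+ m)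
  /\
  ((n%:R * c) ^+ (m * n) * (\det (mxabs A) + `|\det (ptr1 A)| ^+ m)
     <= (\tr (mxabs A)) ^+ (m * n) + `|\det (ptr2 A)| ^+ n).
Proof.
have sA := sectorial_numrange hW.
(* Swapping the indices in [e2] exchanges [m] and [n], so each lemma serves both partial traces. *)
pose e1 := @mxvec_index m n; pose e2 (k : 'I_n) (i : 'I_m) := e1 i k.
have b1 : bijective (fun x : 'I_m * 'I_n => e1 x.1 x.2).
  have [g gK Kg] := @curry_mxvec_bij m n.
  exists g => [[i k]|x]; first exact: (gK (i, k)).
  by have := Kg x isT; case: (g x).
have b2 : bijective (fun x : 'I_n * 'I_m => e2 x.1 x.2).
  have [g gK Kg] := b1; exists (fun x => ((g x).2, (g x).1)) => [[k i]|x].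
    by rewrite (gK (i, k)).
  exact: Kg.
have -> : ptr1 A = ptr e1 A by [].
have -> : ptr2 A = ptr e2 A by [].
(* Terms are paired crosswise: the modulus determinant with a partial trace determinant, and the
   other partial trace determinant with the trace power. *)
rewrite !mulrDr; split; rewrite [X in _ <= X]addrC lerD //.
- exact: det_mxabs_le_det_ptr hc ht hct sA.
- exact: det_ptr_le_tr_mxabs hc ht hct sA.
- exact: det_mxabs_le_det_ptr hc ht hct sA.
- exact: det_ptr_le_tr_mxabs hc ht hct sA.
Qed.
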